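(* There exists a universal constant $C>0$ such that for every $d\ge 1$, every symmetric positive definite $H\in\mathbb{R}^{d\times d}$ with largest eigenvalue $\lambda_{\max}$ and smallest eigenvalue $\lambda_{\min}$, and every mini-batch size $B\ge 1$, the optimal heavy-ball spectral radius $s^*(H,B)$ satisfies $$s^*(H,B)\ \ge\ 1-C\,\min\left\{\frac{B\,\lambda_{\min}}{\mathrm{Tr}(H)},\ \sqrt{\frac{\lambda_{\min}}{\lambda_{\max}}}\right\}.$$ In particular, the transition to the accelerated regime (the batch size at which the two terms in the minimum coincide) occurs at $B^{\mathrm{crit}}_{\mathrm{HB}}=\frac{\mathrm{Tr}(H)\sqrt{\kappa}}{\lambda_{\max}}$, where $\kappa=\lambda_{\max}/\lambda_{\min}$.
   Context: Let $H\in\mathbb{R}^{d\times d}$ be symmetric positive definite with eigenvalues $\lambda_{\max}=\lambda_1\ge\dots\ge\lambda_d=\lambda_{\min}>0$ and let $\Lambda=\mathrm{diag}(\lambda_1,\dots,\lambda_d)$. For a step size $\eta>0$, a momentum parameter $\beta\in[0,1)$ and a batch size $B\ge1$, define the $2d\times 2d$ matrix (in $d\times d$ blocks) $$A=\begin{bmatrix}(1+\beta)I-\eta(1-\beta)\Lambda & -\beta I\\ I & 0\end{bmatrix}.$$ The heavy-ball (HB) covariance operator $\mathcal{T}_{H,\eta,\beta,B}$ is the linear map on the space of real symmetric $2d\times 2d$ matrices given by $$\mathcal{T}_{H,\eta,\beta,B}(S)=A\,S\,A^\top+\eta^2(1-\beta)^2\begin{bmatrix}\tfrac1B\,\mathrm{Tr}(\Lambda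 S^{11})\,\Lambda & 0\\ 0&0\end{bmatrix},$$ where $S^{11}$ is the upper-left $d\times d$ block of $S$. Let $s(H,\eta,\beta,B)=\rho(\mathcal{T}_{H,\eta,\beta,B})$ be its spectral radius (the maximal modulus of its complex eigenvalues), and $$s^*(H,B)=\inf_{\eta>0,\ \beta\in[0,1)}s(H,\eta,\beta,B).$$ *)

(* Defs.v *)
From HB Require Import structures.
From mathcomp Require Import all_boot all_order all_algebra.
From mathcomp Require Import complex.
From mathcomp Require Import all_classical all_reals.

Set Implicit Arguments.
Unset Strict Implicit.
Unset Printing Implicit Defensive.

Import Order.TTheory GRing.Theory Num.Theory.

Local Open Scope classical_set_scope.
Local Open Scope ring_scope.

Definition posdefmx (R : realType) (d : nat) (H : 'M[R]_d) : Prop :=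
  H^T = H /\ forall x : 'rV[R]_d, x != 0 -> 0 < (x *m H *m x^T) 0 0.

(* Eigenvalues with multiplicity, in nonincreasing order.  When H is symmetric
   such a sequence exists (eigvalsP) and is unique, so [::] is never used. *)
Definition eigvals (R : realType) (d : nat) (H : 'M[R]_d) : seq R :=
  xget [::] [set s | sorted >=%R s /\ char_poly H = \prod_(a <- s) ('X - a%:P)].

Lemma eigvalsP (R : realType) (d : nat) (H : 'M[R]_d) : H^T = H ->
  [/\ size (eigvals H) = d, sorted >=%R (eigvals H)
    & char_poly H = \prod_(a <- eigvals H) ('X - a%:P)].
Proof.
move=> Hsym.
have [s Hs] : exists s : seq R, char_poly H = \prod_(a <- s) ('X - a%:P).
  pose HC := map_mx (real_complex R) H.
  have HCherm : HC \is hermsymmx.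
    apply: realsym_hermsym.
      apply/is_hermitianmxP; rewrite expr0 scale1r.
      by apply/matrixP => i j; rewrite !mxE -[in RHS]Hsym mxE.
    by apply/mxOverP => i j; rewrite mxE complex_real.
  have /orthomx_spectralP HCE := hermitian_normalmx HCherm.
  have sp_real := hermitian_spectral_diag_real HCherm.
  set P := spectralmx HC in HCE; set sp := spectral_diag HC in HCE sp_real.
  have cpE : char_poly HC = char_poly (diag_mx sp).
    rewrite /char_poly /char_poly_mx.
    pose pC := map_mx (@polyC R[i]).
    have PV : pC _ _ (invmx P) *m pC _ _ P = 1%:M.
      by rewrite -map_mxM mulVmx ?spectral_unit// map_mx1.
    have -> : 'X%:M - pC _ _ HC =
        pC _ _ (invmx P) *m ('X%:M - pC _ _ (diag_mx sp)) *m pC _ _ P.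
      rewrite mulmxBr mulmxBl {1}HCE {1 2}/pC !map_mxM; congr (_ - _).
      by rewrite scalar_mxC -mulmxA PV mulmx1.
    by rewrite !det_mulmx mulrAC -det_mulmx PV det1 mul1r.
  exists [seq complex.Re (sp 0 i) | i <- enum 'I_d].
  apply: (map_poly_inj (real_complex R)).
  rewrite map_char_poly -/HC cpE char_poly_trig ?diag_mx_is_trig//.
  rewrite rmorph_prod big_map big_enum /=; apply: eq_bigr => i _.
  rewrite mxE eqxx mulr1n rmorphB /= map_polyX map_polyC /=.
  by rewrite RRe_real//; move/mxOverP: sp_real; apply.
have [sS cS] : [set s | sorted >=%R s /\
    char_poly H = \prod_(a <- s) ('X - a%:P)] (eigvals H).
  apply: (xgetPex [::]); exists (sort >=%R s); split.
    by apply: sort_sorted => x y; exact: ge_total.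
  by rewrite Hs; apply: perm_big; rewrite perm_sym perm_sort.
split=> //; apply: succn_inj.
by rewrite -(size_char_poly H) cS size_prod_XsubC.
Qed.

Definition lambda_max (R : realType) (d : nat) (H : 'M[R]_d) : R :=
  (eigvals H)`_0.

Definition lambda_min (R : realType) (d : nat) (H : 'M[R]_d) : R :=
  (eigvals H)`_d.-1.

Definition Lambda (R : realType) (d : nat) (H : 'M[R]_d) : 'M[R]_d :=
  diag_mx (\row_(i < d) (eigvals H)`_i).

Definition hb_mx (R : realType) (d : nat) (H : 'M[R]_d) (eta beta : R) :
    'M[R]_(d + d) :=
  block_mx ((1 + beta)%:M - (eta * (1 - beta)) *: Lambda H) (- beta%:M)
           1%:M 0.

Definition hb_cov (R : realType) (d : nat) (H : 'M[R]_d) (eta beta : R)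
    (B : nat) (S : 'M[R]_(d + d)) : 'M[R]_(d + d) :=
  hb_mx H eta beta *m S *m (hb_mx H eta beta)^T +
  (eta ^+ 2 * (1 - beta) ^+ 2) *:
    block_mx ((B%:R^-1 * \tr (Lambda H *m ulsubmx S)) *: Lambda H) 0 0 0.

Lemma hb_cov_linear (R : realType) (d : nat) (H : 'M[R]_d) (eta beta : R)
  (B : nat) : linear (hb_cov H eta beta B).
Proof.
move=> a S T; rewrite /hb_cov.
pose noise (X : 'M[R]_(d + d)) : 'M[R]_(d + d) :=
  block_mx ((B%:R^-1 * \tr (Lambda H *m ulsubmx X)) *: Lambda H) 0 0 0.
have noiseP : noise (a *: S + T) = a *: noise S + noise T.
  rewrite /noise scale_block_mx add_block_mx !scaler0 !addr0; congr block_mx.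
  have -> : ulsubmx (a *: S + T) = a *: ulsubmx S + ulsubmx T.
    by apply/matrixP => i j; rewrite !mxE.
  by rewrite mulmxDr -scalemxAr mxtraceD mxtraceZ mulrDr mulrCA scalerDl scalerA.
rewrite -!/(noise _) noiseP mulmxDr mulmxDl -scalemxAr -scalemxAl.
rewrite [X in _ + X]scalerDr addrACA [in RHS]scalerDr.
by congr (_ + _ + _); rewrite !scalerA mulrC.
Qed.

Lemma hb_cov_sym (R : realType) (d : nat) (H : 'M[R]_d) (eta beta : R)
  (B : nat) (S : 'M[R]_(d + d)) :
  S^T = S -> (hb_cov H eta beta B S)^T = hb_cov H eta beta B S.
Proof.
move=> Ssym; rewrite /hb_cov linearD linearZ /= !trmx_mul trmxK Ssym mulmxA.
by rewrite tr_block_mx linearZ /= tr_diag_mx !trmx0.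
Qed.

(* T_C (X + i Y) = T X + i T Y *)
Definition complexification (R : realType) (n : nat) (T : 'M[R]_n -> 'M[R]_n)
    (S : 'M[R[i]]_n) : 'M[R[i]]_n :=
  map_mx (real_complex R) (T (map_mx (@complex.Re R) S)) +
  'i%C *: map_mx (real_complex R) (T (map_mx (@complex.Im R) S)).

(* Complex eigenvalues of T as an operator on real symmetric matrices.  The
   complexification of that space consists of the complex symmetric (not the
   Hermitian) matrices. *)
Definition sym_eigenvalue (R : realType) (n : nat) (T : 'M[R]_n -> 'M[R]_n)
    (z : R[i]) : Prop :=
  exists S : 'M[R[i]]_n, [/\ S^T = S, S != 0 & complexification T S = z *: S].

Definition sym_spectral_radius (R : realType) (n : nat)
    (T : 'M[R]_n -> 'M[R]_n) : R :=
  sup [set Normc.normc z | z in sym_eigenvalue T].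

Definition hb_radius (R : realType) (d : nat) (H : 'M[R]_d) (eta beta : R)
    (B : nat) : R :=
  sym_spectral_radius (hb_cov H eta beta B).

Definition hb_opt_radius (R : realType) (d : nat) (H : 'M[R]_d) (B : nat) : R :=
  inf [set r | exists eta beta : R,
    [/\ 0 < eta, 0 <= beta, beta < 1 & r = hb_radius H eta beta B]].

Definition cond_number (R : realType) (d : nat) (H : 'M[R]_d) : R :=
  lambda_max H / lambda_min H.

Definition crit_batch (R : realType) (d : nat) (H : 'M[R]_d) : R :=
  \tr H * Num.sqrt (cond_number H) / lambda_max H.

(* Main.v *)
(* In the eigenbasis the block-diagonal symmetric matrices (one symmetric 2x2
   block per eigenvalue) are invariant under the covariance operator, and on them
   the trace coupling has rank one.  Hence a real z to the right of beta and of
   the squared roots of all characteristic polynomials mu^2 - a_i mu + beta is an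
   eigenvalue as soon as F(z) = 1, where F is the explicit sum [secular].  F
   exceeds 1 near its largest pole and vanishes at infinity, so if the spectral
   radius is below 1 - eps, then every z >= 1 - eps lies beyond all poles and
   F(z) < 1.  Taking z = 1 - eps gives eps < 1 - beta; z = 1 - eps/2 in the
   slowest mode gives eps < 16 eta lambda_min; and at z = 1, F < 1 gives
   eta Tr H < 2B, while stability of the stiffest mode gives
   eta (1 - beta) lambda_max < 4.  These combine into
   eps < 32 B lambda_min / Tr H and eps < 8 sqrt (lambda_min / lambda_max). *)
Require Import Defs.
From HB Require Import structures.
From mathcomp Require Import all_boot all_order all_algebra.
From mathcomp Require Import complex.
From mathcomp Require Import all_classical all_reals.
From mathcomp Require Import ring lra.

Set Implicit Arguments.
Unset Strict Implicit.
Unset Printing Implicit Defensive.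

Import Order.TTheory GRing.Theory Num.Theory.

Local Open Scope ring_scope.

(** * Secular function: poles, growth and solutions *)

(* Equals (z - mu1^2) (z - mu2^2), where mu1 and mu2 are the eigenvalues of the
   2x2 block [[a, - beta], [1, 0]]. *)
Definition hb_quad (R : rcfType) (beta a z : R) : R := (z + beta) ^+ 2 - a ^+ 2 * z.

Definition beyond_poles (R : rcfType) (I : Type) (beta : R) (a : I -> R) (z : R) : Prop :=
  beta < z /\ forall i, 0 < hb_quad beta (a i) z.

(** The secular function of a rank-one perturbation: term i is c lam_i times the (1,1) entry of the
    symmetric 2x2 matrix X solving z X - A_i X A_i^T = lam_i e1 e1^T, where A_i = [[a_i, - beta],
    [1, 0]]. *)
Definition secular (R : rcfType) (I : finType) (c beta : R) (lam a : I -> R) (z : R) : R :=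
  \sum_i c * lam i ^+ 2 * (z * (z + beta)) / ((z - beta) * hb_quad beta (a i) z).

(** The quotient of [hb_quad] by z is z + 2 beta + beta^2 / z - a^2, which increases for z > beta;
    [e] compares its values at y and z with denominators cleared. *)
Lemma hb_quad_mono (R : rcfType) (beta a y z : R) :
  0 <= beta -> beta < y -> y <= z -> 0 < hb_quad beta a y -> 0 < hb_quad beta a z.
Proof.
rewrite /hb_quad => b0 by_ yz q.
have y0 : 0 < y by lra.
rewrite -(pmulr_lgt0 _ y0).
have e : ((z + beta) ^+ 2 - a ^+ 2 * z) * y =
   z * ((y + beta) ^+ 2 - a ^+ 2 * y) + (z - y) * (y * z - beta ^+ 2) by ring.
rewrite e; apply: ltr_wpDr; last by apply: mulr_gt0 => //; lra.
apply: mulr_ge0; first lra.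
by rewrite subr_ge0 expr2 ler_pM //; lra.
Qed.

Section Secular.
Variables (R : rcfType) (I : finType) (c beta : R) (lam a : I -> R).
Hypotheses (c_gt0 : 0 < c) (beta_ge0 : 0 <= beta) (lam_gt0 : forall i, 0 < lam i).

Lemma beyond_poles_mono (y z : R) :
  y <= z -> beyond_poles beta a y -> beyond_poles beta a z.
Proof.
have b0 := beta_ge0.
move=> yz [by_ q]; split; first exact: lt_le_trans yz.
by move=> i; apply: hb_quad_mono yz (q i).
Qed.

Lemma secular_term_ge0 (z : R) (i : I) : beyond_poles beta a z ->
  0 <= c * lam i ^+ 2 * (z * (z + beta)) / ((z - beta) * hb_quad beta (a i) z).
Proof.
have b0 := beta_ge0.
move=> [bz q]; have z0 : 0 < z by lra.
rewrite divr_ge0 // !mulr_ge0 ?exprn_ge0 ?(ltW c_gt0) ?(ltW (lam_gt0 _)) ?(ltW (q i)) //; lra.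
Qed.

(** Past this bound z - beta >= z / 2, z + beta <= 2 z and [hb_quad] is at least z^2 / 2, so each
    term is at most c lam_i^2 times 8 / z. *)
Lemma secular_large (z : R) :
  2 * beta + 2 * (\sum_i a i ^+ 2) + 8 * (\sum_i c * lam i ^+ 2) < z ->
  beyond_poles beta a z /\ secular c beta lam a z < 1.
Proof.
have b0 := beta_ge0.
set K := \sum_i a i ^+ 2; set L := \sum_i c * lam i ^+ 2 => hz.
have K0 : 0 <= K by apply: sumr_ge0 => i _; exact: sqr_ge0.
have L0 : 0 <= L.
  by apply: sumr_ge0 => i _; rewrite mulr_ge0 ?sqr_ge0 ?(ltW c_gt0).
have aK i : a i ^+ 2 <= K.
  by rewrite /K (bigD1 i) //= lerDl; apply: sumr_ge0 => j _; exact: sqr_ge0.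
have z0 : 0 < z by lra.
have q i : z ^+ 2 / 2 <= hb_quad beta (a i) z.
  rewrite /hb_quad; have := aK i; set k := a i ^+ 2 => kK.
  have : k * z <= z / 2 * z by rewrite ler_pM2r //; lra.
  by have : 0 <= beta * z by [exact: mulr_ge0 beta_ge0 (ltW z0)]; nra.
have z20 : 0 < z ^+ 2 by rewrite exprn_gt0.
have gz : beyond_poles beta a z.
  by split=> [|i]; [lra | apply: lt_le_trans (q i); rewrite divr_gt0].
split=> //.
have : secular c beta lam a z <= \sum_i (c * lam i ^+ 2) * (8 / z).
  apply: ler_sum => i _; have [bz qi] := gz.
  rewrite -mulrA ler_pM2l ?mulr_gt0 ?exprn_gt0 //.
  rewrite ler_pdivrMr; last by rewrite mulr_gt0 ?qi ?subr_gt0.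
  apply: (@le_trans _ _ (8 / z * (z / 2 * (z ^+ 2 / 2)))).
    have -> : 8 / z * (z / 2 * (z ^+ 2 / 2)) = z * (2 * z) by field; rewrite gt_eqF.
    by rewrite ler_pM2l //; lra.
  rewrite ler_pM2l ?divr_gt0 // ler_pM //; lra.
move=> /le_lt_trans; apply; rewrite -mulr_suml -/L mulrA ltr_pdivrMr //; lra.
Qed.

(** Term j alone suffices once one factor of its denominator is small: in the first case Q <= (z +
    beta)^2 and z + beta <= 2 z, in the second z - beta <= z + beta. *)
Lemma secular_ge1 (j : I) (z : R) : beyond_poles beta a z ->
  z - beta <= c * lam j ^+ 2 / 2 \/
    hb_quad beta (a j) z <= c * lam j ^+ 2 / 2 * z ->
  1 <= secular c beta lam a z.
Proof.
have b0 := beta_ge0.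
move=> gz; have [bz q] := gz; move: (q j); set Q := hb_quad _ _ _ => Q0 H.
have z0 : 0 < z by lra.
rewrite /secular (bigD1 j) //=; apply: ler_wpDr.
  by apply: sumr_ge0 => i _; exact: secular_term_ge0.
rewrite ler_pdivlMr ?mul1r ?mulr_gt0 ?Q0 ?subr_gt0 // -/Q.
have t0 : 0 < c * lam j ^+ 2 by rewrite mulr_gt0 ?exprn_gt0.
move: H; set t := c * _ in t0 *; case=> H.
  have Qle : Q <= (z + beta) ^+ 2 by rewrite gerBl mulr_ge0 ?sqr_ge0 ?(ltW z0).
  apply: (@le_trans _ _ (t / 2 * (z + beta) ^+ 2)); first by apply: ler_pM => //; lra.
  have -> : t * (z * (z + beta)) = t / 2 * (2 * z * (z + beta)) by field.
  rewrite ler_pM2l ?divr_gt0 // expr2 ler_pM2r; lra.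
apply: (@le_trans _ _ ((z + beta) * (t / 2 * z))); first by apply: ler_pM => //; lra.
have -> : (z + beta) * (t / 2 * z) = (t * (z * (z + beta))) / 2 by ring.
have : 0 < t * (z * (z + beta)) by rewrite !mulr_gt0 //; lra.
lra.
Qed.

(** Multiplying 1 - [secular] by its denominators, positive on [y, z] by [beyond_poles_mono], gives
    the polynomial [N], to which [poly_ivt] applies. *)
Lemma secular_ivt (y z : R) : y <= z -> beyond_poles beta a y ->
  1 <= secular c beta lam a y -> secular c beta lam a z <= 1 ->
  exists x, [/\ y <= x, beyond_poles beta a x & secular c beta lam a x = 1].
Proof.
have b0 := beta_ge0.
move=> yz gy Fy Fz.
pose Qp i : {poly R} := ('X + beta%:P) ^+ 2 - (a i ^+ 2) *: 'X.
pose N : {poly R} := ('X - beta%:P) * \prod_i Qp i -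
  \sum_i (c * lam i ^+ 2) *: ('X * ('X + beta%:P) * \prod_(j | j != i) Qp j).
have QE i x : (Qp i).[x] = hb_quad beta (a i) x by rewrite /Qp !hornerE /hb_quad.
have NE x : beyond_poles beta a x ->
    N.[x] = (x - beta) * (\prod_i hb_quad beta (a i) x) * (1 - secular c beta lam a x).
  move=> [bx q]; rewrite mulrBr mulr1 /N !hornerE horner_prod horner_sum.
  congr (_ * _ - _); first by apply: eq_bigr => i _; rewrite QE.
  rewrite /secular mulr_sumr; apply: eq_bigr => i _.
  have -> : \prod_j hb_quad beta (a j) x =
      hb_quad beta (a i) x * (\prod_(j | j != i) Qp j).[x].
    by rewrite horner_prod (bigD1 i) //=; congr (_ * _); apply: eq_bigr => j _; rewrite QE.
  rewrite !(hornerZ, hornerM, hornerD, hornerX, hornerC); set P := (\prod_(j | _) _).[x].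
  have := q i; set Q := hb_quad _ _ _ => Q0.
  by field; rewrite (gt_eqF Q0) subr_eq0 (gt_eqF bx).
have sgn x : beyond_poles beta a x -> 0 < (x - beta) * \prod_i hb_quad beta (a i) x.
  by move=> [bx q]; rewrite mulr_gt0 ?subr_gt0 ?prodr_gt0.
have gz := beyond_poles_mono yz gy.
have [|x /andP[yx xz] /rootP] := @poly_ivt R N y z yz.
  by rewrite !NE // pmulr_rle0 ?sgn // pmulr_rge0 ?sgn // subr_le0 Fy subr_ge0.
have gx := beyond_poles_mono yx gy.
rewrite NE // => /eqP; rewrite mulf_eq0 gt_eqF ?sgn //= subr_eq0 => /eqP Fx.
by exists x.
Qed.

(* The point just beyond the largest pole is z0 when beta is that pole, and is
   given by the root of p otherwise. *)
Lemma secular_alternative (i0 : I) (r : R) :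
  (exists x, [/\ r <= x, beyond_poles beta a x & secular c beta lam a x = 1]) \/
  (beyond_poles beta a r /\ secular c beta lam a r < 1).
Proof.
have b0 := beta_ge0.
have big y : exists z, [/\ y <= z, beyond_poles beta a z & secular c beta lam a z < 1].
  set B := 2 * beta + 2 * (\sum_i a i ^+ 2) + 8 * (\sum_i c * lam i ^+ 2).
  have [|gz Fz] := @secular_large (Num.max y (B + 1)).
    by rewrite -/B lt_max; apply/orP; right; lra.
  by exists (Num.max y (B + 1)); rewrite le_max lexx.
have sol y : r <= y -> beyond_poles beta a y -> 1 <= secular c beta lam a y ->
    exists x, [/\ r <= x, beyond_poles beta a x & secular c beta lam a x = 1].
  move=> ry gy Fy; have [z [yz _ /ltW Fz]] := big y.
  by have [x [yx gx Fx]] := secular_ivt yz gy Fy Fz; exists x; split=> //; exact: le_trans yx.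
(* The largest a_i^2 gives the smallest quadratic, so positivity for j implies it for all i. *)
have [j _ jmax] := arg_maxP (fun i => a i ^+ 2) (erefl (xpredT i0)).
set t := c * lam j ^+ 2 / 2.
have t0 : 0 < t by rewrite divr_gt0 // mulr_gt0 ?exprn_gt0.
have goodj z : beta < z -> 0 < hb_quad beta (a j) z -> beyond_poles beta a z.
  move=> bz qj; split=> // i; apply: lt_le_trans qj _.
  rewrite /hb_quad lerD2l lerN2 ler_pM2r; last lra.
  exact: jmax.
pose z0 := Num.max r (beta + t).
have rz0 : r <= z0 by rewrite /z0 le_max lexx.
have bz0 : beta + t <= z0 by rewrite /z0 le_max lexx orbT.
(* If [hb_quad] is at least t z0, then z0 is already beyond the poles; otherwise a point x to its
   right with [hb_quad] equal to t x is used. *)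
have [q0|q0] := lerP (t * z0) (hb_quad beta (a j) z0).
  have g0 : beyond_poles beta a z0.
    by apply: goodj; [lra | apply: lt_le_trans q0; rewrite mulr_gt0 //; lra].
  have [rb|br] := leP r (beta + t).
    have z0E : z0 = beta + t by apply/max_idPr.
    left; apply: (sol z0) => //; apply: (@secular_ge1 j) => //; left.
    by rewrite z0E -/t; lra.
  have z0E : z0 = r by apply/max_idPl/ltW.
  rewrite z0E in g0; have [Fr|Fr] := ltP (secular c beta lam a r) 1; first by right.
  by left; exact: sol Fr.
left; pose p : {poly R} := ('X + beta%:P) ^+ 2 - (a j ^+ 2 + t) *: 'X.
have pE x : p.[x] = hb_quad beta (a j) x - t * x.
  by rewrite /p !hornerE /hb_quad mulrDl opprD addrA.
(* Since p(z) = z (z - a_j^2 - t) + 2 beta z + beta^2, this shift makes p(z1) nonnegative. *)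
pose z1 := z0 + a j ^+ 2 + t.
have z01 : z0 <= z1 by rewrite /z1 -addrA lerDl addr_ge0 ?sqr_ge0 ?ltW.
have [|x /andP[z0x _] /rootP] := @poly_ivt R p z0 z1 z01.
  rewrite !pE subr_le0 ltW //= /hb_quad.
  have -> : (z1 + beta) ^+ 2 - a j ^+ 2 * z1 - t * z1 = z1 * z0 + 2 * beta * z1 + beta ^+ 2.
    by rewrite /z1; ring.
  by rewrite !addr_ge0 ?mulr_ge0 ?sqr_ge0 //; lra.
rewrite pE => /eqP; rewrite subr_eq0 => /eqP qx.
have bx : beta < x by lra.
have gx : beyond_poles beta a x by apply: goodj => //; rewrite qx mulr_gt0 //; lra.
apply: (sol x) => //; first exact: le_trans z0x.
by apply: (@secular_ge1 j) => //; right; rewrite qx -/t.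
Qed.
End Secular.

(** * Scalar inequalities for the rate *)

(** Here g = 1 - beta and v = eta lam. Expanding the positivity hypothesis gives [Q2]; if 8 v <= e,
    its left side is at most 4 g v <= g e / 2, while its right side is at least g e / 2. *)
Lemma contraction_le (R : rcfType) (g v e : R) :
  g <= 1 -> 0 < v -> 0 < e -> 2 * e < g ->
  0 < hb_quad (1 - g) (2 - g - g * v) (1 - e) -> e < 8 * v.
Proof.
rewrite /hb_quad => g1 v0 e0 eg Q.
rewrite ltNge; apply/negP => le_v.
have Q2 : g * v * (2 * (2 - g) - g * v) * (1 - e) > e * (g * (2 - g) - e) by lra.
have gv0 : 0 < g * v by rewrite mulr_gt0 //; lra.
have gve : g * v <= g * (e / 8) by rewrite ler_pM2l //; lra.
have ge0 : 0 < g * e by rewrite mulr_gt0 //; lra.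
have gv1 : g * v <= 1 * 1 by rewrite ler_pM //; lra.
have : g * v * (2 * (2 - g) - g * v) * (1 - e) <= g * v * 4 * 1.
  by rewrite ler_pM ?mulr_ge0 ?(ltW v0) ?ler_pM2l //; lra.
have : e * (g / 2) <= e * (g * (2 - g) - e).
  by rewrite ler_pM2l //; have : g * 1 <= g * (2 - g) by [rewrite ler_pM2l; lra]; lra.
lra.
Qed.

Lemma rate_bounds (R : rcfType) (I : finType) (b eta beta eps : R) (lam a : I -> R) (i j : I) :
  0 < b -> 0 < eta -> 0 <= beta -> beta < 1 -> (forall k, 0 < lam k) ->
  (forall k, a k = 1 + beta - eta * (1 - beta) * lam k) ->
  0 < eps -> eps < 1 ->
  (forall z, 1 - eps <= z -> beyond_poles beta a z /\
     secular (eta ^+ 2 * (1 - beta) ^+ 2 * b^-1) beta lam a z < 1) ->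
  eps < 32 * (b * lam i / \sum_k lam k) /\ eps < 32 * Num.sqrt (lam i / lam j).
Proof.
move=> b0 eta0 beta0 beta1 lam0 aE eps0 eps1 H.
have betaeps : beta < 1 - eps by have [] := (H (1 - eps) (lexx _)).1.
have step : eps < 16 * (eta * lam i).
  (* Half of eps is taken because [contraction_le] requires 2 e < 1 - beta. *)
  have [|[_ q] _] := H (1 - eps / 2); first lra.
  have : eps / 2 < 8 * (eta * lam i).
    apply: (@contraction_le R (1 - beta)); rewrite ?subr_gt0 ?mulr_gt0 ?divr_gt0 //; try lra.
    have -> : 1 - (1 - beta) = beta by ring.
    have -> : 2 - (1 - beta) - (1 - beta) * (eta * lam i) = a i by rewrite aE; ring.
    by have := q i; rewrite subr_gt0.
  lra.
have [gs Fs] := H 1 ltac:(lra).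
have q1 k : hb_quad beta (a k) 1 =
    eta * (1 - beta) * lam k * (2 * (1 + beta) - eta * (1 - beta) * lam k).
  by rewrite /hb_quad aE; ring.
have pos k : 0 < eta * (1 - beta) * lam k by rewrite !mulr_gt0 ?subr_gt0.
have stable k : eta * (1 - beta) * lam k < 2 * (1 + beta).
  by have := gs.2 k; rewrite q1 pmulr_rgt0 // subr_gt0.
split.
  have T0 : 0 < \sum_k lam k.
    by rewrite (bigD1 i) //=; apply: ltr_wpDr => //; apply: sumr_ge0 => k _; exact: ltW.
  (* At z = 1 the factor 1 - beta cancels, and term k is at least eta lam_k / (2 b) because 2 (1 +
     beta) / (2 (1 + beta) - u) >= 1. *)
  have : eta / (2 * b) * \sum_k lam k < 1.
    apply: le_lt_trans Fs; rewrite mulr_sumr; apply: ler_sum => k _; rewrite q1.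
    have := stable k; have := pos k; have lk := lam0 k.
    set u := eta * (1 - beta) * lam k => u0 ust.
    have -> : eta ^+ 2 * (1 - beta) ^+ 2 / b * lam k ^+ 2 * (1 * (1 + beta)) /
        ((1 - beta) * (u * (2 * (1 + beta) - u))) =
        eta / (2 * b) * lam k * (2 * (1 + beta) / (2 * (1 + beta) - u)).
      rewrite /u; field; rewrite -/u !gt_eqF //; lra.
    rewrite ler_peMr ?mulr_ge0 ?invr_ge0 ?mulr_ge0 ?(ltW lk) ?(ltW eta0) ?(ltW b0) //.
    by rewrite ler_pdivlMr; lra.
  rewrite mulrAC ltr_pdivrMr ?mulr_gt0 // mul1r => etaT.
  rewrite mulrA ltr_pdivlMr //.
  apply: (@lt_trans _ _ (16 * (eta * lam i) * \sum_k lam k)); first by rewrite ltr_pM2r.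
  have -> : 16 * (eta * lam i) * \sum_k lam k = 16 * lam i * (eta * \sum_k lam k) by ring.
  have -> : 32 * (b * lam i) = 16 * lam i * (2 * b) by ring.
  by rewrite ltr_pM2l ?mulr_gt0.
rewrite -(@ltr_pXn2r _ 2) ?nnegrE ?mulr_ge0 ?sqrtr_ge0 ?(ltW eps0) //.
rewrite exprMn sqr_sqrtr ?divr_ge0 ?(ltW (lam0 _)) // mulrA ltr_pdivlMr //.
(* One factor eps is bounded by 16 eta lam_i, the other by 1 - beta; [stable] then gives eps^2 lam_j
   < 64 lam_i, and 64 < 32^2. *)
apply: (@lt_trans _ _ (16 * (eta * lam i) * (1 - beta) * lam j)).
  by rewrite ltr_pM2r // expr2; apply: ltr_pM => //; rewrite ?(ltW eps0) //; lra.
have -> : 16 * (eta * lam i) * (1 - beta) * lam j = 16 * lam i * (eta * (1 - beta) * lam j) by ring.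
apply: (@lt_trans _ _ (16 * lam i * 4)); last by have := lam0 i; lra.
by rewrite ltr_pM2l ?mulr_gt0 //; have := stable j; lra.
Qed.

(** * Block-diagonal eigenvectors of the covariance operator *)

Section DiagonalBlocks.
Variables (R : realType) (d : nat).
Implicit Types (f g : 'I_d -> R).

(** Indexing by functions turns block products into pointwise identities, which [field] can
    check. *)
Definition fdiag f : 'M[R]_d := diag_mx (\row_i f i).

Lemma eq_fdiag f g : f =1 g -> fdiag f = fdiag g.
Proof. by move=> fg; congr diag_mx; apply/rowP => i; rewrite !mxE. Qed.

Lemma fdiagM f g : fdiag f *m fdiag g = fdiag (fun i => f i * g i).
Proof. by rewrite /fdiag mulmx_diag; congr diag_mx; apply/rowP => i; rewrite !mxE. Qed.

Lemma fdiagD f g : fdiag f + fdiag g = fdiag (fun i => f i + g i).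
Proof. by rewrite /fdiag -linearD; congr diag_mx; apply/rowP => i; rewrite !mxE. Qed.

Lemma fdiagN f : - fdiag f = fdiag (fun i => - f i).
Proof. by rewrite /fdiag -linearN; congr diag_mx; apply/rowP => i; rewrite !mxE. Qed.

Lemma fdiagZ k f : k *: fdiag f = fdiag (fun i => k * f i).
Proof. by rewrite /fdiag -linearZ; congr diag_mx; apply/rowP => i; rewrite !mxE. Qed.

Lemma fdiag_const (k : R) : k%:M = fdiag (fun=> k).
Proof. by rewrite -diag_const_mx; congr diag_mx; apply/rowP => i; rewrite !mxE. Qed.

Lemma fdiag_tr f : (fdiag f)^T = fdiag f.
Proof. exact: tr_diag_mx. Qed.

Lemma tr_fdiag f : \tr (fdiag f) = \sum_i f i.
Proof. by rewrite mxtrace_diag; apply: eq_bigr => i _; rewrite mxE. Qed.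

End DiagonalBlocks.

(* For a block-diagonal S with 2x2 blocks [[x_i, y_i], [y_i, w_i]], the eigenvalue
   equation determines the blocks up to a common factor. *)
Lemma hb_cov_secular_eigen (R : realType) (d : nat) (H : 'M[R]_d) (eta beta : R) (B : nat)
    (lam a : 'I_d -> R) (z : R) :
  (forall i, lam i = (eigvals H)`_i) -> (forall i, 0 < lam i) ->
  (forall i, a i = 1 + beta - eta * (1 - beta) * lam i) ->
  (0 < d)%N -> 0 <= beta -> 0 < eta -> beyond_poles beta a z ->
  secular (eta ^+ 2 * (1 - beta) ^+ 2 * B%:R^-1) beta lam a z = 1 ->
  exists S : 'M[R]_(d + d), [/\ S^T = S, S != 0 & hb_cov H eta beta B S = z *: S].
Proof.
move=> lamE lam0 aE d0 beta0 eta0 [bz q] Fz.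
have z0 : 0 < z by lra.
(* The lower blocks of the equation read z w = x and z y = a x - beta y; the upper-left one then
   gives x, scaled so that the trace coupling is 1. The secular equation confirms that scaling in
   [tauE]. *)
pose x i := lam i * (z * (z + beta)) / ((z - beta) * hb_quad beta (a i) z).
pose y i := a i * x i / (z + beta).
pose w i := x i / z.
have x0 i : 0 < x i.
  by rewrite /x divr_gt0 // !mulr_gt0 ?q //; lra.
exists (block_mx (fdiag x) (fdiag y) (fdiag y) (fdiag w)); split.
- by rewrite tr_block_mx !fdiag_tr.
- apply/eqP => /(congr1 (fun M => ulsubmx M (Ordinal d0) (Ordinal d0))).
  by rewrite block_mxKul !mxE eqxx mulr1n; apply/eqP; rewrite gt_eqF.
have LE : Lambda H = fdiag lam.
  by congr diag_mx; apply/rowP => i; rewrite !mxE.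
have AE : hb_mx H eta beta =
    block_mx (fdiag a) (fdiag (fun=> - beta)) (fdiag (fun=> 1)) (fdiag (fun=> 0)).
  rewrite /hb_mx LE !fdiag_const fdiagZ !fdiagN fdiagD; congr block_mx.
    by apply: eq_fdiag => i; rewrite aE; ring.
  by apply/matrixP => i j; rewrite !mxE mul0rn.
rewrite /hb_cov block_mxKul AE LE tr_block_mx !fdiag_tr !mulmx_block !scale_block_mx.
rewrite add_block_mx !scaler0 !addr0 !(fdiagM, fdiagD, fdiagZ, tr_fdiag).
set tau := \sum_i _.
have tauE : eta ^+ 2 * (1 - beta) ^+ 2 * (B%:R^-1 * tau) = 1.
  rewrite mulrA -[RHS]Fz /tau mulr_sumr; apply: eq_bigr => i _.
  by rewrite /x; ring.
have zb : z + beta != 0 by rewrite gt_eqF //; lra.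
have zn : z != 0 by rewrite gt_eqF.
congr block_mx; apply: eq_fdiag => i.
- rewrite mulrA tauE mul1r /w /y.
  have Q0 : hb_quad beta (a i) z != 0 by rewrite gt_eqF.
  have zmb : z - beta != 0 by rewrite gt_eqF // subr_gt0.
  move: Q0; rewrite /x /hb_quad => Q0; field.
  by rewrite zn zb Q0 zmb.
- by rewrite /y /w; field; rewrite zn zb.
- by rewrite /y /w; field; rewrite zn zb.
- by rewrite /w /y; field; rewrite zn ?zb.
Qed.

(** * Boundedness of the spectrum and real eigenvalues *)

Lemma normc_le_ReIm (R : rcfType) (z : R[i]) :
  Normc.normc z <= `|complex.Re z| + `|complex.Im z|.
Proof.
case: z => x y /=; rewrite -[leRHS]ger0_norm ?addr_ge0 // -[leRHS]sqrtr_sqr ler_wsqrtr //.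
by rewrite sqrrD !real_normK ?num_real // addrAC lerDl mulrn_wge0 ?mulr_ge0.
Qed.

Lemma norm_Re_le (R : rcfType) (z : R[i]) : `|complex.Re z| <= Normc.normc z.
Proof. by case: z => x y /=; rewrite -sqrtr_sqr ler_wsqrtr // lerDl sqr_ge0. Qed.

Lemma norm_Im_le (R : rcfType) (z : R[i]) : `|complex.Im z| <= Normc.normc z.
Proof. by case: z => x y /=; rewrite -sqrtr_sqr ler_wsqrtr // lerDr sqr_ge0. Qed.

Section SpectralRadius.
Variables (R : realType) (n : nat) (T : {linear 'M[R]_n -> 'M[R]_n}).

Let l1 (M : 'M[R]_n) : R := \sum_i \sum_j `|M i j|.

Lemma linear_l1_bound : exists2 K : R, 0 <= K & forall M, l1 (T M) <= K * l1 M.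
Proof.
exists (\sum_k \sum_l l1 (T (delta_mx k l))).
  rewrite sumr_ge0 // => k _; rewrite sumr_ge0 // => l _.
  by rewrite sumr_ge0 // => i _; rewrite sumr_ge0.
have le1 (F : 'I_n -> 'I_n -> R) k l : (forall k l, 0 <= F k l) -> F k l <= \sum_k \sum_l F k l.
  move=> F0; rewrite (bigD1 k) //= (bigD1 l) //= -addrA lerDl addr_ge0 ?sumr_ge0 //.
  by move=> i _; rewrite sumr_ge0.
have l10 M : 0 <= l1 M by rewrite sumr_ge0 // => i _; rewrite sumr_ge0.
have exchange4 (F : 'I_n -> 'I_n -> 'I_n -> 'I_n -> R) :
    \sum_i \sum_j \sum_k \sum_l F i j k l = \sum_k \sum_l \sum_i \sum_j F i j k l.
  transitivity (\sum_i \sum_k \sum_l \sum_j F i j k l).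
    by apply: eq_bigr => i _; rewrite exchange_big; apply: eq_bigr => k _; exact: exchange_big.
  by rewrite exchange_big; apply: eq_bigr => k _; exact: exchange_big.
move=> M; apply: (@le_trans _ _ (\sum_k \sum_l `|M k l| * l1 (T (delta_mx k l)))).
  rewrite {1}/l1 [in leLHS](matrix_sum_delta M) linear_sum /=.
  under eq_bigr do under eq_bigr do rewrite summxE.
  apply: (@le_trans _ _ (\sum_i \sum_j \sum_k \sum_l `|M k l| * `|T (delta_mx k l) i j|)).
    apply: ler_sum => i _; apply: ler_sum => j _.
    apply: le_trans (ler_norm_sum _ _ _) _; apply: ler_sum => k _.
    rewrite linear_sum /= summxE; apply: le_trans (ler_norm_sum _ _ _) _.
    by apply: ler_sum => l _; rewrite linearZ /= mxE normrM.
  rewrite exchange4; apply: ler_sum => k _; apply: ler_sum => l _.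
  rewrite /l1 mulr_sumr; apply: ler_sum => i _.
  by rewrite mulr_sumr.
rewrite {3}/l1 mulr_sumr; apply: ler_sum => k _.
rewrite mulr_sumr; apply: ler_sum => l _; rewrite mulrC ler_wpM2r //.
exact: (le1 (fun k l => l1 (T (delta_mx k l)))).
Qed.

(** Lets [sup] dominate each eigenvalue modulus. With N the sum of the entry moduli of S, summing
    [entry] over i, j bounds |z| N by K N for the real part plus K N for the imaginary part. *)
Lemma has_ubound_sym_spectrum :
  has_ubound [set Normc.normc z | z in sym_eigenvalue T]%classic.
Proof.
have [K K0 HK] := linear_l1_bound; exists (2 * K) => _ [z [S [_ S0 Sz]] <-].
pose N := \sum_i \sum_j Normc.normc (S i j).
have nc0 (w : R[i]) : 0 <= Normc.normc w by case: w => x y; exact: sqrtr_ge0.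
have N0 : 0 < N.
  rewrite lt_neqAle eq_sym andbC sumr_ge0 /=; last by move=> i _; rewrite sumr_ge0.
  apply: contra S0 => /eqP NE; apply/eqP/matrixP => i j; rewrite mxE.
  apply: Normc.eq0_normc; apply/eqP; rewrite eq_le nc0 andbT -NE /N.
  rewrite (bigD1 i) //= (bigD1 j) //= -addrA lerDl addr_ge0 ?sumr_ge0 //.
  by move=> k _; rewrite sumr_ge0.
set A := map_mx (@complex.Re R) S; set B := map_mx (@complex.Im R) S.
have entry i j : Normc.normc z * Normc.normc (S i j) <= `|T A i j| + `|T B i j|.
  have -> : Normc.normc z * Normc.normc (S i j) = Normc.normc (complexification T S i j).
    by rewrite Sz mxE Normc.normcM.
  apply: le_trans (normc_le_ReIm _) _; rewrite !mxE /=.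
  by rewrite !mul0r !mulr0 !mul1r subrr addr0 !add0r.
rewrite -(ler_pM2r N0); apply: (@le_trans _ _ (l1 (T A) + l1 (T B))).
  rewrite /N mulr_sumr /l1 -big_split /=; apply: ler_sum => i _.
  by rewrite mulr_sumr -big_split /=; apply: ler_sum => j _.
have AN : l1 A <= N.
  by apply: ler_sum => i _; apply: ler_sum => j _; rewrite mxE norm_Re_le.
have BN : l1 B <= N.
  by apply: ler_sum => i _; apply: ler_sum => j _; rewrite mxE norm_Im_le.
have := HK A; have := HK B.
have := ler_wpM2l K0 AN; have := ler_wpM2l K0 BN; lra.
Qed.

Lemma sym_spectral_radius_ge0 : 0 <= sym_spectral_radius T.
Proof.
rewrite /sym_spectral_radius; set E := (X in sup X).
(* An empty spectrum would give radius 0, the value of [sup] on the empty set. *)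
have [[x Ex]|/set0P/negP/negPn/eqP ->] := pselect (E !=set0)%classic; last by rewrite sup0.
apply: le_trans (ub_le_sup has_ubound_sym_spectrum Ex).
by case: Ex => -[u v] _ <-; exact: sqrtr_ge0.
Qed.

Lemma real_eigen_le_radius (z : R) (S : 'M[R]_n) :
  S^T = S -> S != 0 -> T S = z *: S -> z <= sym_spectral_radius T.
Proof.
move=> St S0 Sz; apply: (le_trans (ler_norm z)).
apply: (ub_le_sup has_ubound_sym_spectrum); exists (real_complex R z); last first.
  by rewrite /= expr0n addr0 sqrtr_sqr.
exists (map_mx (real_complex R) S); split.
- by apply/matrixP => i j; rewrite -[in RHS]St !mxE.
- by rewrite map_mx_eq0.
rewrite /complexification.
have -> : map_mx (@complex.Re R) (map_mx (real_complex R) S) = S.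
  by apply/matrixP => i j; rewrite !mxE.
have -> : map_mx (@complex.Im R) (map_mx (real_complex R) S) = 0.
  by apply/matrixP => i j; rewrite !mxE.
by rewrite linear0 map_mx0 scaler0 addr0 Sz map_mxZ.
Qed.

End SpectralRadius.

(** * Eigenvalues of H and assembly of the bound *)

Lemma eigvals_gt0 (R : realType) (d : nat) (H : 'M[R]_d) (i : nat) :
  posdefmx H -> (i < d)%N -> 0 < (eigvals H)`_i.
Proof.
move=> [Ht Hpos] id; have [sz _ cp] := eigvalsP Ht.
have : root (char_poly H) (eigvals H)`_i.
  by rewrite cp root_prod_XsubC mem_nth ?sz.
rewrite -eigenvalue_root_char => /eigenvalueP[v vH v0].
have := Hpos v v0; rewrite vH -scalemxAl mxE.
have -> : (v *m v^T) 0 0 = \sum_j v 0 j ^+ 2.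
  by rewrite mxE; apply: eq_bigr => j _; rewrite mxE expr2.
have : 0 <= \sum_j v 0 j ^+ 2 by rewrite sumr_ge0 // => j _; exact: sqr_ge0.
by rewrite le_eqVlt => /orP[/eqP <-|/pmulr_lgt0 ->]; rewrite ?mulr0 ?ltxx.
Qed.

(** Both sides are minus the coefficient of degree d - 1 of the characteristic polynomial. *)
Lemma trace_eigvals (R : realType) (d : nat) (H : 'M[R]_d) :
  (0 < d)%N -> H^T = H -> \tr H = \sum_(i < d) (eigvals H)`_i.
Proof.
move=> d0 Ht; have [sz _ cp] := eigvalsP Ht.
apply: oppr_inj; rewrite -char_poly_trace // cp.
have := @coefPn_prod_XsubC _ (eigvals H); rewrite sz => ->; last by rewrite -lt0n.
by rewrite (big_nth 0) sz big_mkord.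
Qed.

Lemma trace_posdef_gt0 (R : realType) (d : nat) (H : 'M[R]_d) :
  (0 < d)%N -> posdefmx H -> 0 < \tr H.
Proof.
move=> d0 Hp; rewrite trace_eigvals //; last exact: Hp.1.
rewrite (bigD1 (Ordinal d0)) //=; apply: ltr_wpDr; last exact: eigvals_gt0.
by apply: sumr_ge0 => i _; rewrite ltW // eigvals_gt0.
Qed.

HB.instance Definition _ (R : realType) (d : nat) (H : 'M[R]_d) (eta beta : R) (B : nat) :=
  GRing.isLinear.Build R _ _ _ (hb_cov H eta beta B) (hb_cov_linear H eta beta B).

Lemma hb_radius_ge (R : realType) (d : nat) (H : 'M[R]_d) (eta beta : R) (B : nat) :
  (1 <= d)%N -> posdefmx H -> (1 <= B)%N -> 0 < eta -> 0 <= beta -> beta < 1 ->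
  1 - 32 * Num.min (B%:R * lambda_min H / \tr H) (Num.sqrt (lambda_min H / lambda_max H))
    <= hb_radius H eta beta B.
Proof.
move=> d1 Hp B1 eta0 beta0 beta1; set m := Num.min _ _.
(* Here the claimed bound is nonpositive; setting this case aside gives the eps < 1 required by
   [rate_bounds]. *)
have m0 : 32 * m >= 1 -> 1 - 32 * m <= hb_radius H eta beta B.
  move=> hm; apply: (@le_trans _ _ 0); first lra.
  exact: sym_spectral_radius_ge0.
(* With eps = 32 m, a radius below 1 - eps would make [rate_bounds] put m strictly below both
   entries of the minimum, although it equals one of them. *)
have [/m0 //|m1] := lerP 1 (32 * m); rewrite leNgt; apply/negP => small.
pose lam (i : 'I_d) := (eigvals H)`_i.
pose a i := 1 + beta - eta * (1 - beta) * lam i.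
have lam0 i : 0 < lam i by apply: eigvals_gt0.
have dp : (d.-1 < d)%N by rewrite prednK.
pose imin := Ordinal dp; pose imax := Ordinal d1.
have b0 : 0 < B%:R :> R by rewrite ltr0n.
have TE : \tr H = \sum_i lam i by apply: trace_eigvals => //; exact: Hp.1.
have mpos : 0 < m.
  by rewrite lt_min sqrtr_gt0 !divr_gt0 ?mulr_gt0 ?trace_posdef_gt0 ?(lam0 imin) ?(lam0 imax).
have c0 : 0 < eta ^+ 2 * (1 - beta) ^+ 2 / B%:R.
  by rewrite divr_gt0 // mulr_gt0 ?exprn_gt0 ?subr_gt0.
have [||z hz|] := @rate_bounds R 'I_d B%:R eta beta (32 * m) lam a imin imax
    b0 eta0 beta0 beta1 lam0 (fun=> erefl).
- by rewrite mulr_gt0.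
- by [].
(* A solution x >= z would be a real eigenvalue at least 1 - 32 m, above the assumed radius, so only
   the second alternative survives. *)
- have [[x [zx gx Fx]]|//] := @secular_alternative R _ _ beta lam a c0 beta0 lam0 imin z.
  have [S [St S0 Sx]] := hb_cov_secular_eigen (fun=> erefl) lam0 (fun=> erefl) d1 beta0 eta0 gx Fx.
  have := real_eigen_le_radius St S0 Sx; rewrite -/(hb_radius _ _ _ _); lra.
rewrite -TE => h1 h2.
suff : 32 * m < 32 * m by rewrite ltxx.
have : m = B%:R * lambda_min H / \tr H \/ m = Num.sqrt (lambda_min H / lambda_max H).
  by rewrite /m; case: leP; [left | right].
by case=> mE; [apply: (lt_le_trans h1) | apply: (lt_le_trans h2)]; rewrite mE; exact: lexx.
Qed.

Theorem theorem1 (R : realType) :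
  (exists2 C : R, 0 < C &
    forall (d : nat) (H : 'M[R]_d) (B : nat),
      (1 <= d)%N -> posdefmx H -> (1 <= B)%N ->
      hb_opt_radius H B >=
        1 - C * Num.min (B%:R * lambda_min H / \tr H)
                        (Num.sqrt (lambda_min H / lambda_max H))) /\
  (forall (d : nat) (H : 'M[R]_d),
      (1 <= d)%N -> posdefmx H ->
      forall b : R,
        [/\ b * lambda_min H / \tr H = Num.sqrt (lambda_min H / lambda_max H)
              <-> b = crit_batch H,
            b < crit_batch H ->
              b * lambda_min H / \tr H < Num.sqrt (lambda_min H / lambda_max H)
          & crit_batch H < b ->
              Num.sqrt (lambda_min H / lambda_max H) < b * lambda_min H / \tr H]).
Proof.
split.
  exists 32 => // d H B d1 Hp B1; apply: lb_le_inf.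
    (* [lb_le_inf] asks for a nonempty set; any admissible pair serves. *)
    by exists (hb_radius H 1 0 B), 1, 0; split.
  by move=> _ [eta [beta [eta0 beta0 beta1 ->]]]; exact: hb_radius_ge.
move=> d H d1 Hp b.
have min0 : 0 < lambda_min H by apply: eigvals_gt0; rewrite ?prednK.
have max0 : 0 < lambda_max H by apply: eigvals_gt0.
have T0 : 0 < \tr H := trace_posdef_gt0 d1 Hp.
have slope0 : 0 < lambda_min H / \tr H by rewrite divr_gt0.
(* The first entry of the minimum is linear in b with slope lambda_min / Tr H, and the second is its
   value at [crit_batch H]; all three claims then compare b with [crit_batch H]. *)
have critE : Num.sqrt (lambda_min H / lambda_max H) = crit_batch H * (lambda_min H / \tr H).
  rewrite /crit_batch /cond_number.
  (* Writing 1 / kappa as kappa / kappa^2 makes the factor sqrt(kappa) of [crit_batch] appear. *)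
  have -> : lambda_min H / lambda_max H =
      lambda_max H / lambda_min H * (lambda_min H / lambda_max H) ^+ 2.
    by field; rewrite !gt_eqF.
  rewrite sqrtrM ?divr_ge0 ?(ltW min0) ?(ltW max0) // sqrtr_sqr.
  rewrite ger0_norm ?divr_ge0 ?(ltW min0) ?(ltW max0) //.
  by field; rewrite !gt_eqF.
rewrite -mulrA critE !(ltr_pM2r slope0); split=> //; split=> [/mulIf|->] //.
by apply; rewrite gt_eqF.
Qed.
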